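(* Suppose the following statement (A) holds: for all positive integers $d,k$, if $P$ is of maximal size among subsets of $\mathbb{R}^d$ determining at most $k$ distinct $\ell^1$-distances, then $P$ is axis-parallel; and likewise, if $P$ is of maximal size among subsets of $\mathbb{R}^d$ that are contained in some $\ell^1$-sphere and determine at most $k$ distinct $\ell^1$-distances, then $P$ is axis-parallel. Then the following statement (B) holds: for all positive integers $d,k$, if $P\subseteq\mathbb{R}^d$ determines at most $k$ distinct $\ell^1$-distances, then $|P|\le|\Lambda_d(k)|$, and $|P|=|\Lambda_d(k)|$ if and only if $P$ is $\ell^1$-similar to $\Lambda_d(k)$.
   Context: For $x\in\mathbb{R}^d$, $\|x\|_1=\sum_i|x_i|$; a set determines the distance $\lambda$ if $\lambda=\|x-y\|_1$ for two distinct points $x,y$ of the set. An $\ell^1$-sphere is a set $\{x:\|x-c\|_1=r\}$ with $r>0$. $\Lambda_d(k)=\{n\in\mathbb{Z}^d:\|n\|_1\le k,\ n_1+\cdots+n_d\equiv k\pmod 2\}$. A bounded set $P\subseteq\mathbb{R}^d$ is axis-parallel if its largest determined $\ell^1$-distance $\lambda$ occurs in an axis-parallel direction, i.e. there exist $x\in P$ and $1\le i\le d$ with $x+\lambda e_i\in P$ ($e_i$ the $i$-th standard basis vector). Two subsets of $\mathbb{R}^d$ are $\ell^1$-similar if one can be mapped to the other by a composition of translations, reflections about coordinate hyperplanes, dilations, and coordinate permutations. *)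

(* Defs.v *)
From mathcomp Require Import all_boot all_order all_algebra.
From mathcomp Require Import all_fingroup.
From mathcomp Require Import mathcomp_extra boolp classical_sets functions.
From mathcomp Require Import cardinality reals.

Set Implicit Arguments.
Unset Strict Implicit.
Unset Printing Implicit Defensive.

Import Order.TTheory GRing.Theory Num.Theory.

Local Open Scope classical_set_scope.
Local Open Scope card_scope.
Local Open Scope ring_scope.

Definition l1norm (K : numDomainType) (d : nat) (x : 'rV[K]_d) : K :=
  \sum_(i < d) `|x 0 i|.

Definition l1dists (R : realType) (d : nat) (P : set 'rV[R]_d) : set R :=
  [set lam | exists x y, [/\ P x, P y, x <> y & lam = l1norm (x - y)]].

Definition at_most_dists (R : realType) (d k : nat) (P : set 'rV[R]_d) : Prop :=
  l1dists P #<= `I_k.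

Definition l1sphere (R : realType) (d : nat) (c : 'rV[R]_d) (r : R) :
    set 'rV[R]_d :=
  [set x | l1norm (x - c) = r].

Definition in_some_l1sphere (R : realType) (d : nat) (P : set 'rV[R]_d) : Prop :=
  exists (c : 'rV[R]_d) (r : R), 0 < r /\ P `<=` l1sphere c r.

(* Sizes are compared as cardinalities, so that nothing is presupposed about *)
(* the finiteness of the members of the class F.                             *)
Definition maximal_size (T : Type) (F : set (set T)) (P : set T) : Prop :=
  F P /\ forall Q : set T, F Q -> Q #<= P.

(* Boundedness of P need not be required separately: it follows from the     *)
(* existence of a largest determined distance.                               *)
Definition axis_parallel (R : realType) (d : nat) (P : set 'rV[R]_d) : Prop :=
  exists lam : R,
    [/\ l1dists P lam,
        forall mu, l1dists P mu -> mu <= lam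
      & exists (x : 'rV[R]_d) (i : 'I_d), P x /\ P (x + lam *: delta_mx 0 i)].

Definition Lambda (R : realType) (d k : nat) : set 'rV[R]_d :=
  map_mx (fun z : int => z%:~R) @`
    [set n : 'rV[int]_d |
      l1norm n <= k%:Z /\ (\sum_(i < d) n 0 i = k%:Z %[mod 2])%Z].

Arguments Lambda : clear implicits.

Definition coord_reflection (R : realType) (d : nat) (i : 'I_d)
    (x : 'rV[R]_d) : 'rV[R]_d :=
  \row_j (if j == i then - x 0 j else x 0 j).

Inductive l1_similarity (R : realType) (d : nat) :
    ('rV[R]_d -> 'rV[R]_d) -> Prop :=
| l1sim_translation (v : 'rV[R]_d) : l1_similarity (fun x => x + v)
| l1sim_reflection (i : 'I_d) : l1_similarity (coord_reflection i)
| l1sim_dilation (c : R) : 0 < c -> l1_similarity (fun x => c *: x)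
| l1sim_perm (s : 'S_d) : l1_similarity (fun x => col_perm s x)
| l1sim_comp (f g : 'rV[R]_d -> 'rV[R]_d) :
    l1_similarity f -> l1_similarity g -> l1_similarity (f \o g).

(* This relation is symmetric, since the generating maps are invertible and  *)
(* their inverses are again generating maps.                                 *)
Definition l1_similar (R : realType) (d : nat) (P Q : set 'rV[R]_d) : Prop :=
  exists2 f : 'rV[R]_d -> 'rV[R]_d, l1_similarity f & f @` P = Q.

(* Main.v *)
(* Let lam_1 < ... < lam_k be the distances of a maximal set P. Since P is
   axis-parallel, after a translation it contains the poles +-(lam_k/2) e_i, so
   P lies in the ball of radius lam_k/2 about the origin.

   If P lies on a sphere, it lies on the boundary of that ball, and the distance
   of a point to the nearer pole forces |y_i| = (lam_k - lam_j)/2. The slice at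
   this height is a set with at most j distances on a sphere of radius lam_j/2 in
   dimension d - 1. Induction on d bounds P by the lattice sphere |n|_1 = k,
   slice by slice. In the case of equality every slice contains its own poles;
   hence all differences lam_b - lam_a are again distances, which makes the lam_j
   an arithmetic progression and P a copy of the lattice sphere.

   In general the boundary part of P is handled by the spherical case. An interior
   point has norm at most lam_(k-1) - lam_k/2, so the interior part has diameter
   less than lam_(k-1) and at most k - 2 distances; now induct on k, using that
   Lambda_d(k) is the disjoint union of the lattice sphere of radius k and
   Lambda_d(k-2). *)

Require Import Defs.
From mathcomp Require Import all_boot all_order all_algebra.
From mathcomp Require Import all_fingroup.
From mathcomp Require Import mathcomp_extra boolp classical_sets functions.
From mathcomp Require Import cardinality reals finmap.
From mathcomp Require Import zify ring lra.

Set Implicit Arguments.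
Unset Strict Implicit.
Unset Printing Implicit Defensive.

Import Order.TTheory GRing.Theory Num.Theory.

Local Open Scope classical_set_scope.
Local Open Scope card_scope.
Local Open Scope ring_scope.

(** * Cardinal comparison through injections and fibers *)

Lemma card_le_of_inj (T U : Type) (A : set T) (B : set U) (f : T -> U) :
  (forall x, A x -> B (f x)) ->
  (forall x y, A x -> A y -> f x = f y -> x = y) -> A #<= B.
Proof.
move=> fAB finj.
have /card_esym e : f @` A #= A.
  by apply: inj_card_eq => x y /set_mem Ax /set_mem Ay; exact: finj.
rewrite (card_le_eql e); apply: subset_card_le => _ [x Ax <-]; exact: fAB.
Qed.

Lemma card_le_inj (T U : Type) (u0 : U) (A : set T) (B : set U) : A #<= B ->
  exists2 f : T -> U, (forall x, A x -> B (f x)) &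
    (forall x y, A x -> A y -> f x = f y -> x = y).
Proof.
move=> /card_leP[f].
pose g x := if pselect (A x) is left a then val (f (SigSub (mem_set a))) else u0.
have gE x (a : A x) : g x = val (f (SigSub (mem_set a))).
  by rewrite /g; case: pselect => // a'; rewrite (Prop_irrelevance a a').
exists g => [x Ax|x y Ax Ay]; first by rewrite gE; exact: set_valP.
rewrite !gE => /val_inj/(inj (mem_set I) (mem_set I)) e.
exact: (congr1 val e).
Qed.

Lemma sub_card_eq (T : choiceType) (A B : set T) :
  finite_set B -> A `<=` B -> B #<= A -> A = B.
Proof.
move=> finB AB BA; have finA := sub_finite_set AB finB.
apply: fset_set_inj => //; apply/eqP.
rewrite eqEfcard; apply/andP; split; first by rewrite -fset_set_sub.
have /fcard_eq -> // : B #= A by rewrite card_eq_le BA subset_card_le.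
Qed.

Section fibers.
Variables (T U : choiceType) (I : Type) (u0 : U) (A : set T) (B : set U).
Variables (p : T -> I) (q : U -> I).
Hypothesis fiberAB : forall i,
  (A `&` p @^-1` [set i]) #<= (B `&` q @^-1` [set i]).

Let fiber_inj : exists f : T -> U,
  [/\ forall x, A x -> B (f x), forall x, A x -> q (f x) = p x &
      forall x y, A x -> A y -> f x = f y -> x = y].
Proof.
have /choice[f fP] i : exists f : T -> U,
    (forall x, A x -> p x = i -> B (f x) /\ q (f x) = i) /\
    (forall x y, A x -> p x = i -> A y -> p y = i -> f x = f y -> x = y).
  have [f f1 f2] := card_le_inj u0 (fiberAB i).
  by exists f; split=> [x Ax px|x y Ax px Ay py]; [exact: f1|exact: f2].
exists (fun x => f (p x) x); split => [x Ax|x Ax|x y Ax Ay e].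
- by have [/(_ x Ax erefl)[]] := fP (p x).
- by have [/(_ x Ax erefl)[]] := fP (p x).
- have epxy : p x = p y.
    have [/(_ x Ax erefl)[_ <-]] := fP (p x).
    by have [/(_ y Ay erefl)[_ <-]] := fP (p y); rewrite e.
  have [_] := fP (p x); apply => //; by rewrite e epxy.
Qed.

Lemma card_le_fibers : A #<= B.
Proof. by have [f [f1 _ f3]] := fiber_inj; exact: card_le_of_inj f1 f3. Qed.

(** The injection glued from the fibers respects the projections. When [B] is finite and no larger
    than [A] it is onto, so every fiber of [B] is filled; this passes extremality down to slices. *)
Lemma card_ge_fiber i : finite_set B -> B #<= A ->
  (B `&` q @^-1` [set i]) #<= (A `&` p @^-1` [set i]).
Proof.
move=> finB BA; have [f [f1 f2 f3]] := fiber_inj.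
have fAB : f @` A = B.
  apply: sub_card_eq => //; first by move=> _ [x Ax <-]; exact: f1.
  suff /card_esym e : f @` A #= A by rewrite -(card_le_eqr e).
  by apply: inj_card_eq => x y /set_mem Ax /set_mem Ay; exact: f3.
apply: (card_le_trans _ (card_image_le f _)); apply: subset_card_le.
move=> b [+ /= <-]; rewrite -fAB => -[x Ax <-]; exists x => //.
by split => //=; rewrite f2.
Qed.
End fibers.

(** The assumption on axis-parallel sets speaks of maximal sets only, so their existence has to be
    secured; a uniform bound on sizes suffices. *)
Lemma ex_maximal_size (T : Type) (F : set (set T)) (N : nat) :
  F !=set0 -> (forall P, F P -> P #<= `I_N) -> exists P, maximal_size F P.
Proof.
move=> [P0 FP0] bnd.
have sz P : F P -> exists2 n, (n <= N)%N & P #= `I_n.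
  move=> FP; have leP := bnd _ FP.
  have [n e] : finite_set P by exact: card_le_finite leP _.
  by exists n => //; rewrite -card_le_II -(card_le_eql e).
pose pr n := `[< exists2 P, F P & P #= `I_n >].
have [n0 n0N P0n] := sz _ FP0.
have exn : exists n, pr n by exists n0; apply/asboolP; exists P0.
have bn n : pr n -> (n <= N)%N.
  move=> /asboolP[P FP e]; have := bnd _ FP.
  by rewrite (card_le_eql e) card_le_II.
have [m /asboolP[P FP e] mmax] := ex_maxnP exn bn.
exists P; split => // Q FQ; have [n _ en] := sz _ FQ.
rewrite (card_le_eql en) (card_le_eqr e) card_le_II; apply: mmax.
by apply/asboolP; exists Q.
Qed.

(** * The norm and its splitting along one coordinate *)

Section l1norm.
Variables (K : numDomainType) (d : nat).
Implicit Types x y : 'rV[K]_d.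

Lemma l1norm_ge0 x : 0 <= l1norm x.
Proof. by apply: sumr_ge0. Qed.

Lemma l1normN x : l1norm (- x) = l1norm x.
Proof. by apply: eq_bigr => i _; rewrite mxE normrN. Qed.

Lemma l1normD x y : l1norm (x + y) <= l1norm x + l1norm y.
Proof. by rewrite -big_split; apply: ler_sum => i _; rewrite mxE ler_normD. Qed.

Lemma l1norm0 : l1norm (0 : 'rV[K]_d) = 0.
Proof. by apply: big1 => i _; rewrite mxE normr0. Qed.

Lemma l1norm_eq0 x : l1norm x = 0 -> x = 0.
Proof.
move=> /eqP; rewrite psumr_eq0 // => /allP x0; apply/rowP => i.
by rewrite mxE; apply/eqP; rewrite -normr_eq0; exact: (x0 i (mem_index_enum i)).
Qed.

Lemma l1normZ (c : K) x : l1norm (c *: x) = `|c| * l1norm x.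
Proof. by rewrite mulr_sumr; apply: eq_bigr => i _; rewrite mxE normrM. Qed.

Lemma l1norm_delta (i : 'I_d) : l1norm (delta_mx 0 i : 'rV[K]_d) = 1.
Proof.
rewrite /l1norm (bigD1 i)//= mxE !eqxx normr1 big1 ?addr0// => j ji.
by rewrite mxE (negPf ji) andbF normr0.
Qed.

Lemma l1norm_coord x i : `|x 0 i| <= l1norm x.
Proof. by rewrite /l1norm (bigD1 i)//= lerDl sumr_ge0. Qed.
End l1norm.

Lemma l1norm_split (K : numDomainType) d (i : 'I_d.+1) (x : 'rV[K]_d.+1) :
  l1norm x = `|x 0 i| + l1norm (col' i x : 'rV_d).
Proof.
by rewrite /l1norm (bigD1_ord i)//=; congr (_ + _); apply: eq_bigr => j _; rewrite mxE.
Qed.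

Lemma col'_addZdelta (K : nzRingType) d (i : 'I_d.+1) (y : 'rV[K]_d.+1) s :
  col' i (y + s *: delta_mx 0 i) = col' i y.
Proof.
apply/rowP => j; rewrite !mxE/= [lift i j == i]eq_sym (negPf (neq_lift i j)).
by rewrite mulr0 addr0.
Qed.

Definition ins (K : Type) d (i : 'I_d.+1) (a : K) (x : 'rV[K]_d) : 'rV[K]_d.+1 :=
  \row_j if unlift i j is Some j' then x 0 j' else a.

Lemma ins_eq (K : Type) d (i : 'I_d.+1) (a : K) x : ins i a x 0 i = a.
Proof. by rewrite mxE unlift_none. Qed.

Lemma col'_ins (K : Type) d (i : 'I_d.+1) (a : K) x : col' i (ins i a x) = x.
Proof. by apply/rowP => j; rewrite !mxE liftK. Qed.

Lemma row_split_eq (K : Type) d (i : 'I_d.+1) (x y : 'rV[K]_d.+1) :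
  x 0 i = y 0 i -> col' i x = col' i y -> x = y.
Proof.
move=> e1 /rowP e2; apply/rowP => j; case: (unliftP i j) => [j' ->|->//].
by have := e2 j'; rewrite !mxE.
Qed.

(** * Finiteness of sets with few distances *)

Section finite_bound.
Variables (R : realType) (d k : nat) (P : set 'rV[R]_d).

(** The partial order given by the closed orthant with sign vector [eps]; the norm is linear on that
    orthant, so distances add along chains. *)
Let below (eps : {ffun 'I_d -> bool}) (y x : 'rV[R]_d) :=
  forall i, 0 <= (-1) ^+ eps i * (x 0 i - y 0 i).

Let below_norm eps y x : below eps y x ->
  l1norm (x - y) = \sum_i (-1) ^+ eps i * (x 0 i - y 0 i).
Proof.
move=> b; apply: eq_bigr => i _; rewrite !mxE.
by rewrite -[RHS]ger0_norm ?b// normrM normrX normrN1 expr1n mul1r.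
Qed.

Let below_trans eps y x z : below eps y x -> below eps x z ->
  below eps y z /\ l1norm (z - y) = l1norm (z - x) + l1norm (x - y).
Proof.
move=> b1 b2; have b3 : below eps y z.
  move=> i; have -> : z 0 i - y 0 i = (z 0 i - x 0 i) + (x 0 i - y 0 i) by ring.
  by rewrite mulrDr addr_ge0.
split=> //; rewrite !(below_norm b1) (below_norm b2) (below_norm b3).
by rewrite -big_split/=; apply: eq_bigr => i _; ring.
Qed.

Let below_ex (y x : 'rV[R]_d) : exists eps, below eps y x.
Proof.
exists [ffun i => (x 0 i < y 0 i)] => i; rewrite ffunE.
by case: ltP => h; rewrite ?expr0 ?expr1; lra.
Qed.

Definition few_dists_bound : nat :=
  #|{: {ffun {ffun 'I_d -> bool} -> {set 'I_k.+1}}}|.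

(* Record at each x, for every orthant direction eps, the set of distances to
   the points of P below x; adding dist(x,z) to the largest of them shows that
   two points x below z cannot have the same record. *)
Lemma at_most_dists_bound : at_most_dists k P -> P #<= `I_few_dists_bound.
Proof.
move=> Pk; have [e e1 e2] := card_le_inj 0%N Pk.
have finD : finite_set (l1dists P) by exact: card_le_finite Pk _.
(* ['I_k.+1] is nonempty even for [k = 0], as [inord] requires; distances have index [e] below [k],
   so [inord] identifies none of them. *)
pose V x := [ffun eps => [set j : 'I_k.+1 | `[< exists y,
   [/\ P y, y <> x, below eps y x & j = inord (e (l1norm (x - y)))] >]]]%SET :
   {ffun {ffun 'I_d -> bool} -> {set 'I_k.+1}}.
have VP x eps j : (j \in V x eps) <-> exists y,
   [/\ P y, y <> x, below eps y x & j = inord (e (l1norm (x - y)))].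
  by rewrite ffunE inE; split => /asboolP.
suff Vinj x z : P x -> P z -> V x = V z -> x = z.
  rewrite /few_dists_bound (card_le_eqr card_II).
  apply: (@card_le_of_inj _ _ _ _ (fun x => enum_rank (V x))) => // x y Px Py.
  by move=> /enum_rank_inj; exact: Vinj.
move=> Px Pz VE; apply: contrapT => xz.
have [eps xz_eps] := below_ex x z.
have dzx : 0 < l1norm (z - x).
  rewrite lt_neqAle l1norm_ge0 andbT eq_sym; apply/eqP => /l1norm_eq0/eqP.
  by rewrite subr_eq0 => /eqP/esym.
(* Admitting [y = x] puts 0 in [W], so a largest element exists. *)
pose W := [set mu | exists y, [/\ P y, below eps y x & mu = l1norm (x - y)]].
have finW : finite_set W.
  apply: (@sub_finite_set _ _ (0 |` l1dists P)); last by rewrite finite_setU.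
  move=> _ [y [Py _ ->]]; have [->|yx] := pselect (y = x).
    by left; rewrite subrr l1norm0.
  by right; exists x, y; split => // /esym.
have [mu Wmu mumax] : exists2 mu, W mu & forall nu, W nu -> nu <= mu.
  have W0 : W 0 by exists x; split => // [i|]; rewrite ?subrr ?mulr0// l1norm0.
  have [X WX] := finite_fsetP.1 finW.
  have X0 : 0 \in X by move: W0; rewrite WX.
  have [m mX mmax] := @arg_maxP _ _ _ [` X0]%fset xpredT val isT.
  exists (val m); first by rewrite WX; exact: valP.
  by move=> nu; rewrite WX => nuX; exact: (mmax [` nuX]%fset isT).
case: Wmu => y [Py yx_eps muE].
have [yz_eps dE] := below_trans yx_eps xz_eps.
have yz : z <> y.
  move=> E; move: dE; rewrite E subrr l1norm0; have := l1norm_ge0 (x - y).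
  by move: dzx; rewrite E; lra.
have : inord (e (l1norm (z - y))) \in V z eps.
  by apply/VP; exists y; split => // /esym.
rewrite -VE => /VP[u [Pu ux ux_eps /(congr1 val)]].
have Dzy : l1dists P (l1norm (z - y)) by exists z, y; split.
have Dxu : l1dists P (l1norm (x - u)) by exists x, u; split => // /esym.
rewrite /= !inordK; do ?by apply/leqW/e1.
move=> /(e2 _ _ Dzy Dxu) E; have := mumax (l1norm (x - u)).
rewrite -E dE -muE; suff WW : W (l1norm (z - x) + mu) by move=> /(_ WW); lra.
by exists u; split => //; rewrite muE -dE E.
Qed.
End finite_bound.

(** * Increasing sequences of distances *)

(** For [j >= 1], [lam j.+1 - lam 1] is a term below [lam j.+1], hence at most [lam j]; and
    [lam j.+1 - lam j] is a positive term, hence at least [lam 1]. So every gap equals [lam 1]. *)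
Lemma equally_spaced (R : realType) (k : nat) (lam : nat -> R) :
  lam 0%N = 0 -> (forall i j, (i < j <= k)%N -> lam i < lam j) ->
  (forall i j, (i < j <= k)%N -> exists2 l, (l <= k)%N & lam j - lam i = lam l) ->
  forall j, (j <= k)%N -> lam j = j%:R * lam 1%N.
Proof.
move=> lam0 laminc lamsub; elim=> [|j IH] jk; first by rewrite lam0 mul0r.
have mono a b : (b <= k)%N -> (a <= k)%N -> lam a <= lam b -> (a <= b)%N.
  by move=> bk ak h; rewrite leqNgt; apply/negP => ba; have := laminc b a; rewrite ba ak; lra.
have lemono a b : (a <= b)%N -> (b <= k)%N -> lam a <= lam b.
  by rewrite leq_eqVlt => /predU1P[->//|ab] bk; apply/ltW/laminc; rewrite ab.
case: j => [|j] in IH jk *; first by rewrite mul1r.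
suff : lam j.+2 = lam j.+1 + lam 1%N.
  by move=> ->; rewrite IH 1?ltnW// -[j.+2%:R]natr1 mulrDl mul1r.
have l1 : 0 < lam 1%N by rewrite -lam0; apply: laminc; lia.
apply/eqP; rewrite eq_le; apply/andP; split.
- have [|l lk e] := lamsub 1%N j.+2; first by lia.
  suff lj : (l <= j.+1)%N by have := lemono _ _ lj; rewrite -e; move=> /(_ (ltnW jk)); lra.
  by rewrite -ltnS ltnNge; apply/negP => jl; have := lemono _ _ jl lk; lra.
- have [|l lk e] := lamsub j.+1 j.+2; first by lia.
  suff /lemono/(_ lk) : (1 <= l)%N by lra.
  rewrite lt0n; apply/eqP => l0; move: e; rewrite l0 lam0.
  by have := laminc j.+1 j.+2; rewrite leqnn jk => /(_ isT); lra.
Qed.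

Lemma addrBKr (V : zmodType) (x y v : V) : (x + v) - (y + v) = x - y.
Proof. by rewrite opprD addrACA subrr addr0. Qed.

Section distance_enumeration.
Variables (R : realType) (d : nat).
Implicit Types (P Q : set 'rV[R]_d) (lam : nat -> R).

(** The value 0 at index 0 covers coinciding points. The values [lam j] need not all be attained, so
    an initial segment of the same sequence can serve subsets and slices of [P]. *)
Definition dist_enum lam k P : Prop :=
  [/\ lam 0%N = 0, forall i j, (i < j <= k)%N -> lam i < lam j &
      forall mu, l1dists P mu -> exists2 j, (0 < j <= k)%N & mu = lam j].

Lemma dist_enum_ex k P : at_most_dists k P ->
  exists2 l, (l <= k)%N & exists lam, dist_enum lam l P.
Proof.
move=> Pk; have finD : finite_set (l1dists P) by exact: card_le_finite Pk _.
pose s := sort <=%R (fset_set (l1dists P)).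
have Ds mu : l1dists P mu <-> mu \in s.
  by rewrite mem_sort in_fset_set//; split => [/mem_set|/set_mem].
exists (size s); first by rewrite size_sort; exact: geq_card_fset_set.
have path_s : path <%R 0 s.
  rewrite path_sortedE; last exact: lt_trans.
  rewrite sort_lt_sorted fset_uniq andbT; apply/allP => mu /Ds[x [y [_ _ xy ->]]].
  rewrite lt_neqAle l1norm_ge0 andbT; apply/eqP => /esym/l1norm_eq0/eqP.
  by rewrite subr_eq0 => /eqP.
exists (nth 0 (0 :: s)); split => // [i j /andP[ij js]|mu /Ds mus].
  by apply: (sorted_ltn_nth lt_trans) => //; rewrite inE/= ltnS// (leq_trans (ltnW ij)).
by exists (index mu s).+1; rewrite /= ?nth_index// index_mem.
Qed.

Lemma dist_enum_at_most lam k P : dist_enum lam k P -> at_most_dists k P.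
Proof.
case=> _ _ H; apply: (card_le_trans _ (card_image_le (fun j => lam j.+1) _)).
apply: subset_card_le => mu /H[[//|j] /andP[_ jk] ->]; by exists j.
Qed.

Lemma dist_enum_le lam k P i j :
  dist_enum lam k P -> (i <= j <= k)%N -> lam i <= lam j.
Proof.
case=> _ inc _ /andP[]; rewrite leq_eqVlt => /predU1P[->//|ij] jk.
by apply/ltW/inc; rewrite ij.
Qed.

Lemma dist_enum_gt lam k P i j :
  dist_enum lam k P -> (i <= k)%N -> lam j < lam i -> (j <= k)%N -> (j < i)%N.
Proof.
move=> e ik ji jk; rewrite ltnNge; apply/negP => ij.
by have := dist_enum_le e (_ : (i <= j <= k)%N); rewrite ij jk => /(_ isT); lra.
Qed.

Lemma dist_enum_ge0 lam k P j : dist_enum lam k P -> (j <= k)%N -> 0 <= lam j.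
Proof. by move=> e jk; have [<- _ _] := e; apply: (dist_enum_le e). Qed.

Lemma dist_enum_dist lam k P x y : dist_enum lam k P -> P x -> P y ->
  exists2 j, (j <= k)%N & l1norm (x - y) = lam j.
Proof.
move=> [l0 _ H] Px Py; have [->|xy] := pselect (x = y).
  by exists 0%N; rewrite // subrr l1norm0.
have [|j /andP[_ jk] e] := H (l1norm (x - y)); first by exists x, y.
by exists j.
Qed.
End distance_enumeration.

Lemma dist_enum_sub (R : realType) d e lam k j
    (P : set 'rV[R]_d) (Q : set 'rV[R]_e) : dist_enum lam k P ->
  (j <= k)%N -> (forall mu, l1dists Q mu -> l1dists P mu /\ mu <= lam j) ->
  dist_enum lam j Q.
Proof.
move=> eP jk H; have [l0 inc D] := eP; split => //.
  by move=> a b /andP[ab bj]; apply: inc; rewrite ab (leq_trans bj).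
move=> mu /H[/D[l /andP[l0' lk] ->]] lj; exists l => //; rewrite l0'/=.
by rewrite leqNgt; apply/negP => jl; have := inc j l; rewrite jl lk; lra.
Qed.

(** * Lattice spheres and balls *)

Section int_l1norm.
(* Restatements whose ring operations are those of int itself, as lia needs. *)
Variable d : nat.

Lemma zl1norm_ge0 (n : 'rV[int]_d) : 0 <= (l1norm n : int).
Proof. exact: l1norm_ge0. Qed.

Lemma zl1norm_coord (n : 'rV[int]_d) i : `|n 0 i| <= (l1norm n : int).
Proof. exact: l1norm_coord. Qed.

Lemma zl1norm_split i (n : 'rV[int]_d.+1) :
  (l1norm n : int) = `|n 0 i| + (l1norm (col' i n : 'rV_d) : int).
Proof. exact: l1norm_split. Qed.
End int_l1norm.

Definition zsphere d k : set 'rV[int]_d := [set n | l1norm n = k%:Z].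
Definition zball d k : set 'rV[int]_d :=
  [set n | l1norm n <= k%:Z /\ (\sum_(i < d) n 0 i = k%:Z %[mod 2])%Z].

Arguments zsphere : clear implicits.
Arguments zball : clear implicits.

Lemma finite_l1ball d k : finite_set [set n : 'rV[int]_d | l1norm n <= k%:Z].
Proof.
apply: (@card_le_finite _ {ffun 'I_d -> 'I_(k + k).+1} _ setT); last exact: finite_finset.
apply: (@card_le_of_inj _ _ _ _
  (fun n : 'rV[int]_d => [ffun i => inord (absz (n 0 i + k%:Z))])) => //= n m nk mk.
move=> /ffunP e; apply/rowP => i; have := e i; rewrite !ffunE => /(congr1 val)/=.
have := zl1norm_coord n i; have := zl1norm_coord m i => mi ni.
by rewrite !inordK; lia.
Qed.

Lemma finite_zsphere d k : finite_set (zsphere d k).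
Proof. by apply: sub_finite_set (@finite_l1ball d k) => n /= ->. Qed.

Lemma finite_zball d k : finite_set (zball d k).
Proof. by apply: sub_finite_set (@finite_l1ball d k) => n []. Qed.

(** An integer and its absolute value have the same parity, so the parity condition can be read off
    the norm. *)
Lemma zball_norm d (n : 'rV[int]_d) :
  (\sum_(i < d) n 0 i = l1norm n %[mod 2])%Z.
Proof.
have H (a : int) : (2 %| a - `|a|)%Z by lia.
by apply/eqP; rewrite eqz_mod_dvd /l1norm -sumrB; apply: rpred_sum => i _; exact: H.
Qed.

Lemma zballP d k (n : 'rV[int]_d) :
  zball d k n <-> l1norm n <= k%:Z /\ (l1norm n = k%:Z %[mod 2])%Z.
Proof. by rewrite /zball /= zball_norm. Qed.

Lemma zball0 d : zball d 0 = [set 0].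
Proof.
apply/seteqP; split => [n /zballP[n0 _]|_ ->]; last by apply/zballP; rewrite l1norm0.
by apply/l1norm_eq0; have := zl1norm_ge0 n; lia.
Qed.

Lemma zballSS d k : zball d k.+2 = zsphere d k.+2 `|` zball d k.
Proof.
apply/seteqP; split => [n /zballP|n [|/zballP]]; rewrite ?zballP /zsphere/=.
- move=> [n1 n2]; have [e|ne] := eqVneq (l1norm n) k.+2; first by left.
  by right; apply/zballP; lia.
- by move=> ->.
- lia.
Qed.

Lemma zsphere_delta d k (i : 'I_d) (s : bool) :
  zsphere d k ((-1) ^+ s * k%:Z *: delta_mx 0 i).
Proof.
by rewrite /zsphere/= l1normZ l1norm_delta mulr1 normrM normrX normrN1 expr1n mul1r.
Qed.

Lemma zsphere_sub_zball d k : zsphere d k `<=` zball d k.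
Proof. by move=> n; rewrite zballP /zsphere/= => ->. Qed.

(** Moving the first coordinate one step away from 0 is injective and never yields 0 there. With a
    second coordinate available, the pole on the last axis is missed and the growth is strict. *)
Lemma zsphereS d k : zsphere d.+1 k #<= zsphere d.+1 k.+1 /\
  ((0 < d)%N -> ~ (zsphere d.+1 k.+1 #<= zsphere d.+1 k)).
Proof.
pose s (t : int) : int := if 0 <= t then t + 1 else t - 1.
pose f (n : 'rV[int]_d.+1) : 'rV_d.+1 := ins ord0 (s (n 0 ord0)) (col' ord0 n).
have fS n : zsphere d.+1 k n -> zsphere d.+1 k.+1 (f n).
  rewrite /zsphere/= (zl1norm_split ord0) [l1norm (f n)](zl1norm_split ord0).
  by rewrite /f ins_eq col'_ins /s; case: ifP; lia.
have finj n m : f n = f m -> n = m.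
  move=> e; apply: (@row_split_eq _ _ ord0).
    have := congr1 (fun z : 'rV[int]__ => z 0 ord0) e; rewrite /= !ins_eq /s.
    by do 2 case: ifP; lia.
  by have := congr1 (col' ord0) e; rewrite !col'_ins.
split; first by apply: card_le_of_inj fS _ => x y _ _; exact: finj.
case: d => // d in s f fS finj * => _ H.
have /card_esym e : f @` zsphere d.+2 k #= zsphere d.+2 k.
  by apply: inj_card_eq => x y _ _; exact: finj.
have E : f @` zsphere d.+2 k = zsphere d.+2 k.+1.
  apply: sub_card_eq; first exact: finite_zsphere.
    by move=> _ [x xS <-]; exact: fS.
  by rewrite -(card_le_eqr e).
have := @zsphere_delta d.+2 k.+1 ord_max false; rewrite -E => -[n _].
move=> /(congr1 (fun z : 'rV[int]__ => z 0 ord0)); rewrite /= ins_eq !mxE/=.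
by rewrite mulr0 /s; case: ifP; lia.
Qed.

(** Translation by the first unit vector is injective and misses the pole with first coordinate
    [-(k+1)]. *)
Lemma zballS d k : zball d.+1 k #<= zball d.+1 k.+1 /\
  ~ (zball d.+1 k.+1 #<= zball d.+1 k).
Proof.
pose f (n : 'rV[int]_d.+1) := n + delta_mx 0 ord0.
have fS n : zball d.+1 k n -> zball d.+1 k.+1 (f n).
  move=> [n1 n2]; split.
    suff : (l1norm (f n) : int) <= (l1norm n : int) + 1 by lia.
    by rewrite -[X in _ + X](@l1norm_delta int d.+1 ord0); exact: l1normD.
  have -> : \sum_i f n 0 i = \sum_i n 0 i + 1.
    under eq_bigr do rewrite mxE.
    rewrite big_split/=; congr (_ + _); rewrite (bigD1 ord0)//= mxE/= big1 ?addr0// => j j0.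
    by rewrite mxE (negPf j0) andbF.
  move: n2; set S := \sum_(_ < _) _; lia.
have finj n m : f n = f m -> n = m by exact: addIr.
split; first by apply: card_le_of_inj fS _ => x y _ _; exact: finj.
move=> H.
have /card_esym e : f @` zball d.+1 k #= zball d.+1 k.
  by apply: inj_card_eq => x y _ _; exact: finj.
have E : f @` zball d.+1 k = zball d.+1 k.+1.
  apply: sub_card_eq; first exact: finite_zball.
    by move=> _ [x xS <-]; exact: fS.
  by rewrite -(card_le_eqr e).
have := zsphere_sub_zball (@zsphere_delta d.+1 k.+1 ord0 true); rewrite -E => -[n [n1 _]].
move=> /(congr1 (fun z : 'rV[int]__ => z 0 ord0)); rewrite /= !mxE/=.
by have := zl1norm_coord n ord0; lia.
Qed.

Lemma zsphere_le d k l : (k <= l)%N -> zsphere d.+1 k #<= zsphere d.+1 l.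
Proof.
move=> /subnK <-; elim: (l - k)%N => [|m IH]; first by rewrite add0n.
by apply: card_le_trans IH _; rewrite addSn; case: (zsphereS d (m + k)).
Qed.

(** Strict growth recovers the radius from sizes; this later identifies the index of the diameter of
    an extremal set with the allowed number of distances. *)
Lemma zsphere_ge d k l : (0 < d)%N ->
  zsphere d.+1 l #<= zsphere d.+1 k -> (l <= k)%N.
Proof.
move=> d0 H; rewrite leqNgt; apply/negP => kl.
have [_ /(_ d0)] := zsphereS d k; apply; apply: card_le_trans H.
exact: zsphere_le.
Qed.

Lemma zball_le d k l : (k <= l)%N -> zball d.+1 k #<= zball d.+1 l.
Proof.
move=> /subnK <-; elim: (l - k)%N => [|m IH]; first by rewrite add0n.
by apply: card_le_trans IH _; rewrite addSn; case: (zballS d (m + k)).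
Qed.

Lemma zball_ge d k l : zball d.+1 l #<= zball d.+1 k -> (l <= k)%N.
Proof.
move=> H; rewrite leqNgt; apply/negP => kl.
by have [_] := zballS d k; apply; apply: card_le_trans H; exact: zball_le.
Qed.

(** * Scaled and translated copies of lattice sets *)

Section copies.
Variable R : realType.

Definition emb d : 'rV[int]_d -> 'rV[R]_d := map_mx (fun z : int => z%:~R).

Definition copy d (m : 'rV[R]_d) (c : R) (A : set 'rV[int]_d) : set 'rV[R]_d :=
  (fun n => m + c *: emb n) @` A.

Lemma emb_inj d : injective (@emb d).
Proof.
move=> x y /rowP e; apply/rowP => i; have := e i; rewrite !mxE => /eqP.
by rewrite eqr_int => /eqP.
Qed.

Lemma l1norm_emb d (n : 'rV[int]_d) : l1norm (emb n) = (l1norm n)%:~R.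
Proof.
by rewrite /l1norm rmorph_sum/=; apply: eq_bigr => i _; rewrite mxE intr_norm.
Qed.

Lemma embB d (n m : 'rV[int]_d) : emb (n - m) = emb n - emb m.
Proof. by apply/rowP => i; rewrite !mxE intrB. Qed.

Lemma copy_card d m (c : R) (A : set 'rV[int]_d) : c != 0 -> copy m c A #= A.
Proof.
move=> c0; apply: inj_card_eq => x y _ _ /addrI/(scalerI c0); exact: emb_inj.
Qed.

Lemma finite_copy d m (c : R) (A : set 'rV[int]_d) :
  finite_set A -> finite_set (copy m c A).
Proof. exact: finite_image. Qed.

Lemma sub_copy_eq d m (c : R) (A : set 'rV[int]_d) P : c != 0 -> finite_set A ->
  P `<=` copy m c A -> A #<= P -> P = copy m c A.
Proof.
move=> c0 finA sub AP; apply: sub_card_eq => //; first exact: finite_copy.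
by rewrite (card_le_eql (copy_card m A c0)).
Qed.

(* The 2d poles of the copy lie on the sphere of radius r about the origin,
   which pins down both the centre and the scale. *)
Lemma copy_zsphere_center d k m (c r : R) : (0 < d)%N -> (0 < k)%N -> 0 < c ->
  (forall y, copy m c (zsphere d k) y -> l1norm y = r) ->
  m = 0 /\ c * k%:R = r.
Proof.
case: d m => // d m _ k0 c0 H.
have ck : 0 < c * k%:R by rewrite mulr_gt0 ?ltr0n.
have pole i (s : bool) : l1norm (m + c *: emb ((-1) ^+ s * k%:Z *: delta_mx 0 i)) = r.
  by apply: H; exists ((-1) ^+ s * k%:Z *: delta_mx 0 i) => //; exact: zsphere_delta.
have poleE i (s : bool) : r = `|m 0 i + (-1) ^+ s * (c * k%:R)| + l1norm (col' i m).
  rewrite -(pole i s) (l1norm_split i); congr (`|_| + _).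
    by rewrite !mxE !eqxx mulr1 intrM rmorphXn/= rmorphN1; ring.
  apply: eq_bigr => j _; rewrite !mxE/= [lift i j == i]eq_sym (negPf (neq_lift i j)).
  by rewrite mulr0 mulr0 addr0.
have m0 : m = 0.
  (* Opposite poles give [|t + a| = |t - a|] with [a > 0], so the coordinate [t] of the centre
     vanishes. *)
  apply/rowP => i; have := poleE i false; rewrite (poleE i true) mxE !(expr0, expr1) !mulN1r mul1r.
  by move=> /addIr; move: (c * _) ck (m 0 i) => a a0 t; do 2![case: ger0P => ?]; lra.
split=> //; rewrite (poleE ord0 false) m0 mxE expr0 mul1r add0r gtr0_norm//.
by rewrite /l1norm big1 ?addr0// => i _; rewrite !mxE normr0.
Qed.
End copies.

(** * Recentering at the midpoint of an axis-parallel diameter *)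

Section recentering.
Variables (R : realType) (d : nat) (P : set 'rV[R]_d.+1) (lam : nat -> R) (k : nat).
Hypothesis eP : dist_enum lam k P.

(** The shift [m] is the midpoint of the diameter. With [a = lam l / 2], the farther end is at
    distance [l1norm y + a] from [y], which is at most [2a]. The index [l] of the diameter may be
    less than [k]. *)
Lemma axis_parallel_center : axis_parallel P ->
  exists l i m, [/\ (0 < l <= k)%N, dist_enum lam l [set x | P (x + m)],
    P (lam l / 2 *: delta_mx 0 i + m), P (- (lam l / 2 *: delta_mx 0 i) + m) &
    forall y, P (y + m) -> l1norm y <= lam l / 2].
Proof.
move=> [mu [Dmu mumax [x [i [Px Pxi]]]]].
have [l0 inc D] := eP.
have [l /andP[lgt0 lk] muE] := D _ Dmu; rewrite {}muE in mumax Pxi Dmu.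
have ll0 : 0 < lam l by rewrite -l0; apply: inc; rewrite lgt0.
exists l, i, (x + lam l / 2 *: delta_mx 0 i).
have top : P (lam l / 2 *: delta_mx 0 i + (x + lam l / 2 *: delta_mx 0 i)).
  by rewrite addrCA -scalerDl -splitr.
have bot : P (- (lam l / 2 *: delta_mx 0 i) + (x + lam l / 2 *: delta_mx 0 i)).
  by rewrite addrC addrK.
split => //; first by rewrite lgt0.
- apply: (dist_enum_sub eP) => // nu [u [v [/= Pu Pv uv nuE]]].
  have Dnu : l1dists P nu.
    exists (u + (x + lam l / 2 *: delta_mx 0 i)), (v + (x + lam l / 2 *: delta_mx 0 i)).
    by split => //; [move=> /addIr|rewrite addrBKr].
  by split => //; exact: mumax.
- move=> y Py; have dist u v : P u -> P v -> l1norm (u - v) <= lam l.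
    move=> Pu Pv; have [->|uv] := pselect (u = v); first by rewrite subrr l1norm0 ltW.
    by apply: mumax; exists u, v.
  have := dist _ _ Py top; have := dist _ _ Py bot; rewrite !addrBKr opprK.
  rewrite !(l1norm_split i) !mxE !eqxx !mulr1.
  rewrite col'_addZdelta -scaleNr col'_addZdelta; have := l1norm_ge0 (col' i y).
  move: (l1norm _) (y 0 i) => u t u0.
  by case: (ger0P t) => h; do 2![case: ger0P => ?]; lra.
Qed.
End recentering.

(** Both poles lying on the sphere forces [c 0 i = 0] and [r = a + l1norm (col' i c)]; the triangle
    inequality in the other coordinates gives the bound. The centre [c] may differ from the
    origin. *)
Lemma sphere_center (R : realType) d (Q : set 'rV[R]_d.+1) c r a i :
  0 < a -> Q `<=` l1sphere c r ->
  Q (a *: delta_mx 0 i) -> Q (- (a *: delta_mx 0 i)) ->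
  forall y, Q y -> a <= l1norm y.
Proof.
move=> a0 QS /QS top /QS bot y /QS; move: top bot; rewrite /l1sphere/=.
rewrite !(l1norm_split i) !mxE !eqxx !mulr1.
have colE s : col' i (s *: delta_mx 0 i - c) = - col' i c.
  by apply/rowP => j; rewrite !mxE/= [lift i j == i]eq_sym (negPf (neq_lift i j)) mulr0 add0r.
rewrite colE -scaleNr colE l1normN => top bot.
have -> : col' i (y - c) = col' i y - col' i c by apply/rowP => j; rewrite !mxE.
have := l1normD (col' i y) (- col' i c); rewrite l1normN; move: top bot.
have := l1norm_ge0 (col' i c).
move: (l1norm _) (l1norm _) (l1norm _) (c 0 i) (y 0 i) => u v w t z u0.
by do 4![case: ger0P => ?]; lra.
Qed.

(** * The spherical case *)

Definition sphere_claim (R : realType) (d : nat) : Prop :=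
  forall j (Q : set 'rV[R]_d) c r, (0 < j)%N -> 0 < r ->
  Q `<=` l1sphere c r -> at_most_dists j Q ->
  Q #<= zsphere d j /\
  (zsphere d j #<= Q -> exists m e, 0 < e /\ Q = copy m e (zsphere d j)).

(** On a sphere about the origin the copy has centre 0 and a known scale. The degenerate pair
    [r = 0], [j = 0] is added because the slices at the two poles are single points. *)
Lemma sphere_claim_centered (R : realType) d j (Q : set 'rV[R]_d) r :
  sphere_claim R d -> (0 < d)%N -> r = 0 /\ j = 0%N \/ 0 < r /\ (0 < j)%N ->
  (forall y, Q y -> l1norm y = r) -> at_most_dists j Q ->
  Q #<= zsphere d j /\ (zsphere d j #<= Q ->
    exists2 e, 0 < e /\ e * j%:R = r & Q = copy 0 e (zsphere d j)).
Proof.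
move=> claim d0 [[-> ->]|[r0 j0]] Qr Qj; last first.
  have [|le eq] := claim j Q 0 r j0 r0 _ Qj; first by move=> y /Qr; rewrite /l1sphere/= subr0.
  split=> // /eq[m [e [e0 QE]]].
  have [||||m0 er] := @copy_zsphere_center R d j m e r => //; first by rewrite -QE.
  by exists e => //; rewrite QE m0.
have z0 : zsphere d 0 = [set 0].
  apply/seteqP; split => [n|_ ->]; first exact: l1norm_eq0.
  by rewrite /zsphere/= l1norm0.
have Q0 y : Q y -> y = 0 by move=> /Qr/l1norm_eq0.
split=> [|H].
  apply: (card_le_of_inj (f := fun=> 0)) => [x _|x y /Q0-> /Q0->//].
  by rewrite z0.
exists 1; first by rewrite mulr0.
apply: sub_copy_eq => //; [exact: oner_neq0|exact: finite_zsphere|].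
move=> y /Q0 ->; exists 0; first by rewrite z0.
by rewrite add0r scale1r; apply/rowP => i; rewrite !mxE.
Qed.

Section sphere_core.
Variables (R : realType) (d : nat).
Hypotheses (d0 : (0 < d)%N) (claim : sphere_claim R d).
Variables (k : nat) (lam : nat -> R) (P : set 'rV[R]_d.+1) (i : 'I_d.+1).
Hypotheses (k0 : (0 < k)%N) (eP : dist_enum lam k P).
Hypothesis sphP : forall y, P y -> l1norm y = lam k / 2.
Hypotheses (top : P (lam k / 2 *: delta_mx 0 i))
           (bot : P (- (lam k / 2 *: delta_mx 0 i))).

Let height (s : bool) j := (-1) ^+ s * ((lam k - lam j) / 2).

(** The distance to the pole on the side of [y] is [lam k / 2 - |y_i| + u], with [u] the norm of the
    other coordinates, while [|y_i| + u = lam k / 2]. The two equations determine [|y_i|] and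
    [u]. *)
Let level y : P y -> exists s j, [/\ (j <= k)%N, y 0 i = height s j &
  l1norm (col' i y : 'rV_d) = lam j / 2].
Proof.
move=> Py; have := sphP Py; rewrite (l1norm_split i) => ny.
have lamk := dist_enum_ge0 eP (leqnn k).
have nc := l1norm_ge0 (col' i y : 'rV_d).
have [y0|y0] := leP 0 (y 0 i).
- have [j jk] := dist_enum_dist eP Py top.
  rewrite (l1norm_split i) -scaleNr col'_addZdelta !mxE !eqxx mulr1 => E.
  exists false, j; split => //; rewrite /height ?expr0.
    by move: (y 0 i) (l1norm _) y0 nc ny E => t u y0 nc; do 2![case: ger0P => ?]; lra.
  by move: (y 0 i) (l1norm _) y0 nc ny E => t u y0 nc; do 2![case: ger0P => ?]; lra.
- have [j jk] := dist_enum_dist eP Py bot.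
  rewrite (l1norm_split i) opprK col'_addZdelta !mxE !eqxx mulr1 => E.
  exists true, j; split => //; rewrite /height ?expr1.
    by move: (y 0 i) (l1norm _) y0 nc ny E => t u y0 nc; do 2![case: ger0P => ?]; lra.
  by move: (y 0 i) (l1norm _) y0 nc ny E => t u y0 nc; do 2![case: ger0P => ?]; lra.
Qed.

Let slice v : set 'rV[R]_d := (col' i : 'rV_d.+1 -> 'rV_d) @` (P `&` [set y | y 0 i = v]).

Let slice_card v : slice v #= P `&` [set y | y 0 i = v].
Proof.
apply: inj_card_eq => x y /set_mem[_ /= ex] /set_mem[_ /= ey].
by apply: row_split_eq; rewrite ex ey.
Qed.

(** Points of a slice agree in coordinate [i], so their distances are distances of [P]; on a sphere
    of radius [lam j / 2] these are at most [lam j]. *)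
Let slice_claim s j : (j <= k)%N ->
  slice (height s j) #<= zsphere d j /\ (zsphere d j #<= slice (height s j) ->
    exists2 e, 0 < e /\ e * j%:R = lam j / 2 &
      slice (height s j) = copy 0 e (zsphere d j)).
Proof.
move=> jk; have [l0 inc _] := eP.
have lamjk : lam j <= lam k by apply: (dist_enum_le eP); rewrite jk leqnn.
have norm_slice y : slice (height s j) y -> l1norm y = lam j / 2.
  move=> [z [Pz /= zi] <-]; have := sphP Pz; rewrite (l1norm_split i) zi.
  rewrite normrM normrX normrN1 expr1n mul1r ger0_norm; first by lra.
  by rewrite divr_ge0// subr_ge0.
apply: sphere_claim_centered => //.
  case: j jk {lamjk norm_slice} => [|j] jk; [left|right].
    by rewrite l0 mul0r.
  by split => //; rewrite divr_gt0// -l0; apply: inc.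
apply: (@dist_enum_at_most _ _ lam); apply: (dist_enum_sub eP) => // mu.
move=> [x [y [Sx Sy xy ->]]]; split; last first.
  have := l1normD x (- y); rewrite l1normN (norm_slice _ Sx) (norm_slice _ Sy); lra.
have [u [Pu /= ui] uE] := Sx; have [v [Pv /= vi] vE] := Sy; exists u, v; split => //.
  by move=> uv; apply: xy; rewrite -uE -vE uv.
rewrite (l1norm_split i) !mxE ui vi subrr normr0 add0r; congr l1norm.
by rewrite -uE -vE; apply/rowP => t; rewrite !mxE.
Qed.

(** Sends a lattice point to the real height of its level, so that slices of [P] and of the lattice
    sphere are fibers over the same index. *)
Let zheight (n : 'rV[int]_d.+1) : R :=
  height (n 0 i < 0) (k - absz (n 0%R i))%N.

Let zsphere_slice s j : (j <= k)%N -> zsphere d j #<=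
  zsphere d.+1 k `&` zheight @^-1` [set height s j].
Proof.
move=> jk; apply: (@card_le_of_inj _ _ _ _ (ins i ((-1) ^+ s * (k - j)%N%:Z))).
  move=> n nj; split.
    rewrite /zsphere/= (zl1norm_split i) col'_ins ins_eq nj.
    by case: s; rewrite ?expr0 ?expr1; lia.
  rewrite /zheight/= ins_eq.
  have -> : (k - absz ((-1) ^+ s * (k - j)%N%:Z)%R = j)%N by case: s; rewrite ?expr0 ?expr1; lia.
  (* The coordinate 0 has lost the sign [s], but both signs give height 0. *)
  have [->|jk'] := eqVneq j k; first by rewrite /height subrr mul0r !mulr0.
  by congr height; case: s; rewrite ?expr0 ?expr1; lia.
by move=> x y _ _ /(congr1 (col' i)); rewrite !col'_ins.
Qed.

Let fiber_le v :
  (P `&` (fun y : 'rV[R]_d.+1 => y 0 i) @^-1` [set v]) #<=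
  (zsphere d.+1 k `&` zheight @^-1` [set v]).
Proof.
have [->|/set0P[y [Py /= yv]]] := eqVneq
   (P `&` (fun y : 'rV[R]_d.+1 => y 0 i) @^-1` [set v]) set0; first exact: card_ge0.
have [s [j [jk yE _]]] := level Py; rewrite -yv yE.
apply: card_le_trans (zsphere_slice s jk).
by rewrite -(card_le_eql (slice_card _)); case: (slice_claim s jk).
Qed.

Lemma sphere_core_le : P #<= zsphere d.+1 k.
Proof. exact: (card_le_fibers 0 fiber_le). Qed.

Lemma sphere_core_eq : zsphere d.+1 k #<= P ->
  exists m e, 0 < e /\ P = copy m e (zsphere d.+1 k).
Proof.
move=> zP; have [l0 inc _] := eP.
have sliceE s j : (j <= k)%N -> exists2 e, 0 < e /\ e * j%:R = lam j / 2 &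
      slice (height s j) = copy 0 e (zsphere d j).
  move=> jk; have [_] := slice_claim s jk; apply; rewrite (card_le_eqr (slice_card _)).
  apply: card_le_trans (zsphere_slice s jk) _.
  exact: (card_ge_fiber 0 fiber_le _ (@finite_zsphere _ _) zP).
pose o : 'I_d := Ordinal d0.
(* Each slice contains its pole on an axis other than [i]. From [w a] to [w b] the height and the
   pole coordinate each change by half of [lam b - lam a], so this difference is itself a
   distance. *)
pose w j := ins i (height false j) (lam j / 2 *: delta_mx 0 o).
have Pw j : (j <= k)%N -> P (w j).
  move=> jk; have [e [e0 ej] sE] := sliceE false j jk.
  have : slice (height false j) (lam j / 2 *: delta_mx 0 o).
    rewrite sE; exists ((-1) ^+ false * j%:Z *: delta_mx 0 o); first exact: zsphere_delta.
    rewrite add0r -ej; apply/rowP => t; rewrite !mxE expr0 mul1r.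
    by case: (t == o); rewrite ?mulr1 ?mulr0.
  move=> [y [Py /= yi] yE]; suff -> : w j = y by [].
  by apply: (@row_split_eq _ _ i); rewrite /w ?ins_eq ?col'_ins.
have lamE : forall j, (j <= k)%N -> lam j = j%:R * lam 1%N.
  apply: equally_spaced => // a b /andP[ab bk].
  have [l lk e] := dist_enum_dist eP (Pw b bk) (Pw a (leq_trans (ltnW ab) bk)).
  exists l => //; rewrite -e (l1norm_split i) !mxE unlift_none.
  have -> : col' i (w b - w a) = ((lam b - lam a) / 2) *: delta_mx 0 o.
    by apply/rowP => t; rewrite !mxE liftK !mxE; ring.
  rewrite l1normZ l1norm_delta mulr1 /height !expr0 !mul1r.
  have : lam a < lam b by apply: inc; rewrite ab.
  by do 2![case: ger0P => ?]; lra.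
have l1 : 0 < lam 1%N by rewrite -l0; apply: inc.
exists 0, (lam 1%N / 2); split; first by rewrite divr_gt0.
apply: sub_copy_eq => //; [by rewrite gt_eqF ?divr_gt0|exact: finite_zsphere|].
move=> y Py; have [s [j [jk yi ny]]] := level Py.
have [n nj nE] : exists2 n, zsphere d j n & col' i y = lam 1%N / 2 *: emb R n.
  have [e [e0 ej] sE] := sliceE s j jk.
  have : slice (height s j) (col' i y) by exists y.
  rewrite sE => -[n nj <-]; exists n => //; rewrite add0r.
  (* For [j = 0] the slice leaves [e] undetermined, but then [n = 0]. *)
  have [j0|j0] := posnP j.
    suff -> : emb R n = 0 by rewrite !scaler0.
    by apply: l1norm_eq0; rewrite l1norm_emb nj j0.
  congr (_ *: _); apply: (mulIf (_ : j%:R != 0)); first by rewrite pnatr_eq0 -lt0n.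
  by rewrite ej lamE//; ring.
exists (ins i ((-1) ^+ s * (k - j)%N%:Z) n).
  rewrite /zsphere/= (zl1norm_split i) col'_ins ins_eq nj.
  by case: (s); rewrite ?expr0 ?expr1; lia.
rewrite add0r; apply: (@row_split_eq _ _ i).
  rewrite !mxE unlift_none yi /height (lamE _ jk) (lamE k)// -mulrBl -natrB//.
  by case: (s); rewrite ?expr0 ?expr1 ?mul1r ?mulN1r ?intrN; ring.
by rewrite nE; apply/rowP => t; rewrite !mxE liftK.
Qed.
End sphere_core.

(** * Translation back, and the induction on the dimension *)

Section shifts.
Variables (R : realType) (d : nat) (P : set 'rV[R]_d) (v : 'rV[R]_d).

Lemma shift_card : [set x | P (x + v)] #= P.
Proof.
suff -> : [set x | P (x + v)] = (fun x => x - v) @` P.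
  by apply: inj_card_eq => x y _ _; exact: addIr.
apply/seteqP; split => [x Px|_ [y /= Py <-]]; last by rewrite /= subrK.
by exists (x + v); rewrite ?addrK.
Qed.

Lemma shift_copy m c A : [set x | P (x + v)] = copy m c A -> P = copy (m + v) c A.
Proof.
move=> E; apply/seteqP; split => [x Px|_ [n An <-]].
  have : copy m c A (x - v) by rewrite -E/= subrK.
  by move=> [n An nE]; exists n => //; rewrite addrAC nE subrK.
have : copy m c A (m + c *: emb R n) by exists n.
by rewrite -E/= addrAC.
Qed.
End shifts.

(** A sphere in the line is the pair [c - r], [c + r], a copy of [{-j, j}] at scale [r / j]. *)
Lemma sphere_claim1 (R : realType) : sphere_claim R 1.
Proof.
move=> j Q c r j0 r0 Qr _.
have e0 : 0 < r / j%:R by rewrite divr_gt0 ?ltr0n.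
have sub : Q `<=` copy c (r / j%:R) (zsphere 1 j).
  move=> y /Qr; rewrite /l1sphere/= /l1norm big_ord1 !mxE => yr.
  exists ((-1) ^+ (y 0 ord0 - c 0 ord0 < 0)%R * j%:Z *: delta_mx 0 ord0); first exact: zsphere_delta.
  apply/rowP => t; rewrite !mxE [t]ord1 eqxx mulr1 intrM rmorphXn/= rmorphN1.
  rewrite mulrCA divfK ?pnatr_eq0 -?lt0n// -yr.
  by case: ltrP => h; rewrite ?expr0 ?expr1; [rewrite ltr0_norm|rewrite ger0_norm]; lra.
split=> [|jQ].
  by rewrite -(card_le_eqr (copy_card c _ (lt0r_neq0 e0))); exact: subset_card_le.
exists c, (r / j%:R); split => //.
apply: sub_copy_eq sub jQ; [exact: lt0r_neq0|exact: finite_zsphere].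
Qed.

(** Recentering bounds the norms from above and [sphere_center] bounds them from below, so the
    shifted set lies on a sphere about the origin. *)
Lemma sphere_axis_parallel (R : realType) d j (P : set 'rV[R]_d.+1) :
  (0 < d)%N -> sphere_claim R d -> in_some_l1sphere P -> at_most_dists j P ->
  axis_parallel P ->
  exists2 l, (l <= j)%N & P #<= zsphere d.+1 l /\ (zsphere d.+1 l #<= P ->
    exists m e, 0 < e /\ P = copy m e (zsphere d.+1 l)).
Proof.
move=> d0 claim [c [r [r0 Pr]]] /dist_enum_ex[l' l'j [lam eP]].
move=> /(axis_parallel_center eP)[l [i [m [/andP[l0 ll'] eQ top bot ball]]]].
have lam0 : 0 < lam l / 2.
  by have [z inc _] := eP; rewrite divr_gt0// -z inc// l0.
have sph y : P (y + m) -> l1norm y = lam l / 2.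
  move=> Py; apply/eqP; rewrite eq_le ball//=.
  apply: (@sphere_center _ _ [set x | P (x + m)] (c - m) r _ i) => //.
  by move=> x /= /Pr; rewrite /l1sphere/= opprB addrA addrAC.
exists l; first exact: leq_trans ll' l'j.
split.
  by rewrite -(card_le_eql (shift_card P m)); exact: sphere_core_le eQ sph top bot.
rewrite -(card_le_eqr (shift_card P m)).
move=> /(sphere_core_eq d0 claim l0 eQ sph top bot)[m' [e [e0 E]]].
by exists (m' + m), e; split => //; exact: shift_copy.
Qed.

(** The bound is first obtained for a maximal set, which exists and is axis-parallel by assumption.
    A set attaining the bound is then itself maximal, so the equality case applies to it. *)
Lemma sphere_claim_all (R : realType) :
  (forall d k, (0 < d)%N -> (0 < k)%N -> forall P : set 'rV[R]_d,
     maximal_size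
       [set Q : set 'rV[R]_d | in_some_l1sphere Q /\ at_most_dists k Q] P ->
     axis_parallel P) ->
  forall d, sphere_claim R d.+1.
Proof.
move=> HA; elim=> [|d claim]; first exact: sphere_claim1.
move=> j P c r j0 r0 Pr Pj.
have Psph : in_some_l1sphere P by exists c, r.
have bound (Q : set 'rV[R]_d.+2) : in_some_l1sphere Q -> at_most_dists j Q -> Q #<= zsphere d.+2 j.
  move=> Qsph Qj.
  have [||N [[Nsph Nj] Nmax]] := @ex_maximal_size _
      [set Q : set 'rV[R]_d.+2 | in_some_l1sphere Q /\ at_most_dists j Q]
      (few_dists_bound d.+2 j); [by exists Q| |].
    by move=> M [_]; exact: at_most_dists_bound.
  have [|l lj [Nl _]] := sphere_axis_parallel (ltn0Sn d) claim Nsph Nj _.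
    by apply: (HA _ j) => //; split.
  apply: (card_le_trans (Nmax Q _)); first by split.
  by apply: card_le_trans Nl _; exact: zsphere_le.
split; first exact: bound.
move=> jP; have [|l lj [Pl Pe]] := sphere_axis_parallel (ltn0Sn d) claim Psph Pj _.
  apply: (HA _ j) => //; split => // Q [Qsph Qj].
  exact: card_le_trans (bound Q Qsph Qj) jP.
have jl : l = j.
  apply/eqP; rewrite eqn_leq lj/=; apply: (@zsphere_ge d.+1) => //.
  exact: card_le_trans jP Pl.
by move: Pe; rewrite jl; apply.
Qed.

(** * The general case *)

Definition ball_claim (R : realType) (d k : nat) : Prop :=
  forall P : set 'rV[R]_d, at_most_dists k P ->
  P #<= zball d k /\
  (zball d k #<= P -> exists m e, 0 < e /\ P = copy m e (zball d k)).

Lemma ball_claim0 (R : realType) d : ball_claim R d 0.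
Proof.
move=> P P0; have Peq x y : P x -> P y -> x = y.
  move=> Px Py; apply: contrapT => xy.
  move: P0; rewrite /at_most_dists II0 => /card_le0P/seteqP[H _].
  by have := H (l1norm (x - y)); apply; exists x, y.
split.
  by apply: (@card_le_of_inj _ _ _ _ (fun=> 0)) => [x _|x y Px Py _]; [rewrite zball0|exact: Peq].
move=> zP; have [y Py] : P !=set0.
  apply/set0P/eqP => PE; move: zP; rewrite PE zball0 => /card_le0P/seteqP[H _].
  by have := H 0; apply.
exists y, 1; split => //; apply: sub_copy_eq => //; [exact: oner_neq0|exact: finite_zball|].
move=> x Px; exists 0; first by rewrite zball0.
rewrite scale1r (Peq _ _ Px Py); apply/rowP => i; by rewrite !mxE addr0.
Qed.

(** The [k + 1] terms of the progression occur among [k + 1] increasing values, so the index map is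
    a strictly increasing self-map of [0..k], hence the identity. *)
Lemma arith_progression_enum (R : realType) k (lam : nat -> R) b :
  0 < b -> (forall i j, (i < j <= k)%N -> lam i < lam j) ->
  (forall j, (j <= k)%N -> exists2 l, (l <= k)%N & b * j%:R = lam l) ->
  forall j, (j <= k)%N -> lam j = b * j%:R.
Proof.
move=> b0 inc H.
have lt a c : (a <= k)%N -> lam a < lam c -> (a < c)%N.
  move=> ak ac; rewrite ltnNge; apply/negP; rewrite leq_eqVlt => /predU1P[E|ca].
    by move: ac; rewrite E ltxx.
  by have := inc c a; rewrite ca ak => /(_ isT); lra.
have bS n : b * n%:R < b * n.+1%:R by rewrite ltr_pM2l// ltr_nat.
have lo : forall j, (j <= k)%N -> forall l, (l <= k)%N -> b * j%:R = lam l -> (j <= l)%N.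
  elim=> // j IH jk l lk E; have [l' l'k E'] := H j (ltnW jk).
  apply: leq_ltn_trans (IH (ltnW jk) l' l'k E') _; apply: lt => //.
  by rewrite -E -E'.
have hi : forall t, (t <= k)%N -> forall l, (l <= k)%N -> b * (k - t)%:R = lam l -> (l <= k - t)%N.
  elim=> [_ l|t IH tk l lk E]; first by rewrite subn0.
  have [l' l'k E'] := H (k - t)%N (leq_subr _ _).
  have := IH (ltnW tk) l' l'k E'; have : (l < l')%N; last by lia.
  by apply: lt => //; rewrite -E -E' subnS -[in X in _ < X](prednK (_ : (0 < k - t)%N)) ?subn_gt0.
move=> j jk; have [l lk E] := H j jk; rewrite E; congr lam.
have jl := lo j jk l lk E.
have := hi (k - j)%N (leq_subr _ _) l lk; rewrite subKn// => /(_ E) lj.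
by apply/eqP; rewrite eqn_leq jl.
Qed.

(** Lattice points on the edge joining the pole on the first axis to the pole on the last one; their
    distances from the former are [0, 2, ..., 2k]. *)
Definition zedge d k j : 'rV[int]_d.+2 :=
  (k - j)%N%:Z *: delta_mx 0 ord0 + j%:Z *: delta_mx 0 ord_max.

Lemma zedge_zsphere d k j : (j <= k)%N -> zsphere d.+2 k (zedge d k j).
Proof.
move=> jk; rewrite /zsphere/= (zl1norm_split ord0).
have -> : col' ord0 (zedge d k j) = j%:Z *: delta_mx 0 ord_max.
  by apply/rowP => i; rewrite !mxE/= mulr0 add0r.
by rewrite l1normZ l1norm_delta mulr1 !mxE/=; lia.
Qed.

Lemma zedge_dist (R : realType) d k j (m : 'rV[R]_d.+2) c : (j <= k)%N -> 0 < c ->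
  l1norm ((m + c *: emb R (zedge d k j)) - (m + c *: emb R (zedge d k 0))) = 2 * c * j%:R.
Proof.
move=> jk c0; rewrite opprD addrACA subrr add0r -scalerBr -embB l1normZ l1norm_emb.
have -> : zedge d k j - zedge d k 0 = j%:Z *: (delta_mx 0 ord_max - delta_mx 0 ord0).
  by apply/rowP => i; rewrite !mxE subn0 -subzn//; ring.
rewrite l1normZ gtr0_norm// intrM.
suff -> : l1norm (delta_mx 0 ord_max - delta_mx 0 ord0 : 'rV[int]_d.+2) = 2.
  by rewrite -mulrA; ring.
have cE : col' ord0 (delta_mx 0 ord_max - delta_mx 0 ord0 : 'rV[int]_d.+2) =
    delta_mx 0 ord_max :> 'rV[int]_d.+1 by apply/rowP => i; rewrite !mxE/= subr0.
by rewrite (zl1norm_split ord0) cE l1norm_delta !mxE.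
Qed.

Section ball_core.
Variables (R : realType) (d : nat).
Hypothesis claim : sphere_claim R d.+2.
Variables (k : nat) (lam : nat -> R) (P : set 'rV[R]_d.+2) (i : 'I_d.+2).
Hypotheses (IH : forall l, (l < k)%N -> ball_claim R d.+2 l).
Hypotheses (k0 : (0 < k)%N) (eP : dist_enum lam k P).
Hypothesis ballP : forall y, P y -> l1norm y <= lam k / 2.
Hypotheses (top : P (lam k / 2 *: delta_mx 0 i))
           (bot : P (- (lam k / 2 *: delta_mx 0 i))).

Let on_sphere (y : 'rV[R]_d.+2) := l1norm y == lam k / 2.
Let boundary := P `&` on_sphere @^-1` [set true].
Let interior := P `&` on_sphere @^-1` [set false].

Let lamk : 0 < lam k.
Proof. by have [z inc _] := eP; rewrite -z inc ?k0 /=. Qed.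

(** The pole on the opposite side is at distance [l1norm y + lam k / 2], which is below [lam k] for
    an interior point and hence at most [lam k.-1]. *)
Let interior_norm y : interior y -> l1norm y <= lam k.-1 - lam k / 2.
Proof.
move=> [Py /= /negbT ny]; have {}ny : l1norm y < lam k / 2 by rewrite lt_neqAle ny ballP.
suff [l lk lE] : exists2 l, (l <= k)%N & l1norm y + lam k / 2 = lam l.
  suff : lam l <= lam k.-1 by lra.
  apply: (dist_enum_le eP); rewrite leq_pred andbT -ltnS prednK//.
  by apply: (dist_enum_gt eP) => //; lra.
have lk0 : 0 < lam k := lamk.
have [y0|y0] := leP 0 (y 0 i).
- have [l lk lE] := dist_enum_dist eP Py bot; exists l => //; move: lE.
  rewrite opprK !(l1norm_split i) col'_addZdelta !mxE !eqxx mulr1.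
  by move: (y 0 i) (l1norm _) y0 => t u y0; do 2![case: ger0P => ?]; lra.
- have [l lk lE] := dist_enum_dist eP Py top; exists l => //; move: lE.
  rewrite !(l1norm_split i) -scaleNr col'_addZdelta !mxE !eqxx mulr1.
  by move: (y 0 i) (l1norm _) y0 => t u y0; do 2![case: ger0P => ?]; lra.
Qed.

(** Two interior points are at most [2 lam_(k-1) - lam_k < lam_(k-1)] apart, so both top distances
    disappear. For [k = 1] the norm bound is negative. *)
Let interior_at_most : k = 1%N /\ interior = set0 \/
  exists2 l, k = l.+2 & at_most_dists l interior.
Proof.
have [z inc D] := eP; have lk0 : 0 < lam k := lamk.
have [k1|k1] := leqP k 1; [left|right].
  have kE : k = 1%N by apply/eqP; rewrite eqn_leq k1.
  split=> //; rewrite -subset0 => y /interior_norm; rewrite [in lam k.-1]kE z.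
  by have := l1norm_ge0 y; lra.
have kE : k = k.-2.+2 by lia.
exists k.-2 => //; apply: (@dist_enum_at_most _ _ lam).
apply: (dist_enum_sub eP) => [|mu [x [y [Ix Iy xy muE]]]]; first by lia.
have Dmu : l1dists P mu by exists x, y; split => //; [case: Ix|case: Iy].
split=> //; have [l /andP[l0 lk] lE] := D _ Dmu; rewrite lE.
apply: (dist_enum_le eP); rewrite (leq_trans (leq_pred _) (leq_pred _)) andbT.
suff : (l < k.-1)%N by lia.
apply: (dist_enum_gt eP) => //; first by rewrite leq_pred.
rewrite -lE muE; have := l1normD x (- y); rewrite l1normN.
have := interior_norm Ix; have := interior_norm Iy.
have : lam k.-1 < lam k by apply: inc; rewrite leqnn andbT prednK.
lra.
Qed.

Let boundary_claim : boundary #<= zsphere d.+2 k /\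
  (zsphere d.+2 k #<= boundary ->
   exists2 e, 0 < e /\ e * k%:R = lam k / 2 & boundary = copy 0 e (zsphere d.+2 k)).
Proof.
apply: sphere_claim_centered => //.
- by right; split => //; rewrite divr_gt0.
- by move=> y [_ /= /eqP].
- apply: card_le_trans (dist_enum_at_most eP); apply: subset_card_le.
  by move=> _ [x [y [[Px _] [Py _] xy ->]]]; exists x, y.
Qed.

Let zon_sphere (n : 'rV[int]_d.+2) := l1norm n == k%:Z.

Let zboundary : zsphere d.+2 k `<=` zball d.+2 k `&` zon_sphere @^-1` [set true].
Proof. by move=> n nk; split; [exact: zsphere_sub_zball|apply/eqP]. Qed.

Let zinterior l : k = l.+2 ->
  zball d.+2 l `<=` zball d.+2 k `&` zon_sphere @^-1` [set false].
Proof.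
move=> kE n nl; split; first by rewrite kE zballSS; right.
by case: nl => nl _; rewrite /zon_sphere/= kE; apply/eqP; lia.
Qed.

Let fiber_le b : (P `&` on_sphere @^-1` [set b]) #<=
  (zball d.+2 k `&` zon_sphere @^-1` [set b]).
Proof.
case: b; first by apply: (card_le_trans boundary_claim.1); exact: subset_card_le.
have [[_ I0]|[l kE Il]] := interior_at_most.
  by rewrite -/interior I0; exact: card_ge0.
have [|le _] := IH _ Il; first by rewrite kE.
by apply: (card_le_trans le); apply: subset_card_le; exact: zinterior.
Qed.

Lemma ball_core_le : P #<= zball d.+2 k.
Proof. exact: (card_le_fibers 0 fiber_le). Qed.

(** Boundary and interior are both extremal, hence copies of the lattice sphere and of the smaller
    ball; the work is to show that the two copies share centre and scale. *)
Lemma ball_core_eq : zball d.+2 k #<= P ->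
  exists m e, 0 < e /\ P = copy m e (zball d.+2 k).
Proof.
move=> zP; have [z inc D] := eP.
have fib b := card_ge_fiber 0 fiber_le b (@finite_zball _ _) zP.
have [_ []] := boundary_claim.
  by apply: card_le_trans (subset_card_le zboundary) (fib true).
move=> e [e0 ek] bE.
have bP n : zsphere d.+2 k n -> P (0 + e *: emb R n).
  move=> nk; suff [] : boundary (0 + e *: emb R n) by [].
  by rewrite bE; exists n.
(* The edge points of the boundary realise [0, 2e, ..., 2ek] among the [k + 1] values of [lam]. *)
have lamE : forall j, (j <= k)%N -> lam j = 2 * e * j%:R.
  apply: arith_progression_enum => //; first by rewrite mulr_gt0.
  move=> j jk; rewrite -(zedge_dist (0 : 'rV[R]_d.+2) jk e0).
  have [l lk ->] := dist_enum_dist eP (bP _ (zedge_zsphere d jk)) (bP _ (zedge_zsphere d (leq0n k))).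
  by exists l.
exists 0, e; split => //.
apply: sub_copy_eq zP; [exact: lt0r_neq0|exact: finite_zball|].
have bsub y : P y -> on_sphere y -> copy 0 e (zball d.+2 k) y.
  move=> Py ny; have : boundary y by split.
  by rewrite bE => -[n nk <-]; exists n => //; exact: zsphere_sub_zball.
have [[_ I0]|[l kE Il]] := interior_at_most => y Py.
  apply: bsub => //; apply/negPn/negP => ny.
  have : interior y by split => //=; apply/negbTE.
  by rewrite I0.
have [ny|ny] := boolP (on_sphere y); first exact: bsub.
have {Py ny}Iy : interior y by split => //=; apply/negbTE.
have [|_ []] := IH _ Il; first by rewrite kE.
  by apply: card_le_trans (fib false); apply: subset_card_le; exact: zinterior.
move=> m [c [c0 iE]].
(* This is [2e(l + 1) - e(l + 2) = el]. *)
have rad : lam k.-1 - lam k / 2 = e * l%:R.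
  by rewrite lamE ?leq_pred// [lam k]lamE// kE/= -[l.+2%:R]natr1 -[l.+1%:R]natr1; field.
have inorm n : zball d.+2 l n -> l1norm (m + c *: emb R n) <= e * l%:R.
  by move=> nl; rewrite -rad; apply: interior_norm; rewrite iE; exists n.
suff icE n : zball d.+2 l n -> m + c *: emb R n = 0 + e *: emb R n.
  move: Iy; rewrite iE => -[n nl <-]; rewrite icE//; exists n => //.
  by have [] := zinterior kE nl.
(* For [l = 0] the interior is one point and [c] is arbitrary; the norm bound 0 places the point at
   the origin. *)
move=> nl; have [l0|l0] := posnP l.
  have := inorm n nl; rewrite l0 mulr0 add0r => h.
  have -> : emb R n = 0.
    by move: nl; rewrite l0 zball0 => ->; apply/rowP => t; rewrite !mxE.
  rewrite !scaler0 addr0; apply: l1norm_eq0; apply/eqP; rewrite eq_le l1norm_ge0 andbT.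
  move: (inorm 0); rewrite l0 zball0 mulr0 => /(_ erefl).
  by rewrite (_ : emb R 0 = 0) ?scaler0 ?addr0//; apply/rowP => t; rewrite !mxE.
have zl (n' : 'rV[int]_d.+2) : zsphere d.+2 l n' -> P (m + c *: emb R n').
  move=> /zsphere_sub_zball n'l; suff [] : interior (m + c *: emb R n') by [].
  by rewrite iE; exists n'.
(* Adjacent edge points of the interior copy are [2c] apart, which is at least [lam 1 = 2e]. *)
have ce : e <= c.
  have E := zedge_dist m l0 c0.
  have [t tk tE] := dist_enum_dist eP (zl _ (zedge_zsphere d l0)) (zl _ (zedge_zsphere d (leq0n l))).
  have t0 : (0 < t)%N.
    by rewrite lt0n; apply/eqP => t0; move: tE; rewrite E t0 z; lra.
  have : lam 1%N <= lam t by apply: (dist_enum_le eP); rewrite t0.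
  by rewrite -tE E lamE//; lra.
have el : e * l%:R <= c * l%:R by rewrite ler_wpM2r.
(* Opposite poles of the interior copy give [|m_j + cl| <= el] and [|m_j - cl| <= el]; as
   [el <= cl], this forces [m_j = 0] and [cl = el]. *)
have mc j : m 0 j = 0 /\ c * l%:R = e * l%:R.
  have pole (s : bool) : `|m 0 j + (-1) ^+ s * (c * l%:R)| <= e * l%:R.
    apply: le_trans (inorm _ (zsphere_sub_zball (@zsphere_delta _ l j s))).
    apply: le_trans (l1norm_coord _ j); rewrite !mxE !eqxx mulr1 intrM rmorphXn/= rmorphN1.
    by rewrite mulrCA.
  move: (pole false) (pole true); rewrite expr0 expr1 mul1r mulN1r !ler_norml.
  by move=> /andP[_ p1] /andP[p2 _]; split; lra.
have -> : m = 0 by apply/rowP => j; rewrite mxE; case: (mc j).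
have [_ cl] := mc ord0; congr (_ + _ *: _).
by apply: mulIf cl; rewrite pnatr_eq0 -lt0n.
Qed.
End ball_core.

(** * Dimension one, and the induction on [k] *)

(** Every point is the leftmost one shifted by some [lam j], so there are at most [l + 1] points. In
    the extremal case all shifts occur and their differences are distances, so [equally_spaced]
    applies. *)
Lemma ball_claim1 (R : realType) k : ball_claim R 1 k.
Proof.
move=> P Pk; have [l lk [lam eP]] := dist_enum_ex Pk.
have Iz : `I_k.+1 #<= zball 1 k.
  apply: (@card_le_of_inj _ _ _ _ (fun j => const_mx (2 * j%:Z - k%:Z))) => [j jk|a b _ _].
    split; rewrite /l1norm big_ord1 mxE; first by move: jk; rewrite /=; lia.
    by lia.
  by move=> /rowP/(_ ord0); rewrite !mxE; lia.
have [->|/set0P[y0 Py0]] := eqVneq P set0.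
  split; first exact: card_ge0.
  move=> /(card_le_trans Iz)/card_le0P/seteqP[H _].
  by have := H 0%N; case.
have finP : finite_set P by apply: card_le_finite (at_most_dists_bound Pk) _.
have [x0 Px0 x0min] : exists2 x0, P x0 & forall y, P y -> x0 0 0 <= y 0 0.
  have [X PX] := finite_fsetP.1 finP.
  have y0X : y0 \in X by move: Py0; rewrite PX.
  have [m _ mmin] := @arg_minP _ _ _ [` y0X]%fset xpredT (fun y => val y 0 0) isT.
  exists (val m); first by rewrite PX; exact: valP.
  by move=> y; rewrite PX => yX; exact: (mmin [` yX]%fset isT).
pose g j : 'rV[R]_1 := x0 + const_mx (lam j).
have subg : P `<=` g @` `I_l.+1.
  move=> y Py; have [j jl jE] := dist_enum_dist eP Py Px0; exists j => //.
  apply/rowP => t; rewrite !mxE -jE /l1norm big_ord1 !mxE [t]ord1 ger0_norm ?subr_ge0 ?x0min//.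
  by rewrite addrC subrK.
have Pl : P #<= `I_l.+1.
  by apply: card_le_trans (card_image_le g _); exact: subset_card_le.
split.
  by apply: (card_le_trans Pl); apply: card_le_trans Iz; rewrite card_le_II.
move=> zP; have kP := card_le_trans Iz zP.
have lE : l = k.
  apply/eqP; rewrite eqn_leq lk/= -ltnS -card_le_II; exact: card_le_trans kP Pl.
rewrite {}lE in eP subg Pl.
have [z inc _] := eP.
have PE : P = g @` `I_k.+1.
  apply: sub_card_eq => //; first exact: finite_image.
  exact: card_le_trans (card_image_le g _) kP.
have Pg j : (j <= k)%N -> P (g j) by move=> jk; rewrite PE; exists j.
have lamE : forall j, (j <= k)%N -> lam j = j%:R * lam 1%N.
  apply: equally_spaced => // a b /andP[ab bk].
  have [t tk tE] := dist_enum_dist eP (Pg b bk) (Pg a (leq_trans (ltnW ab) bk)).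
  exists t => //; rewrite -tE /l1norm big_ord1 !mxE.
  have : lam a < lam b by apply: inc; rewrite ab.
  by case: ger0P => ?; lra.
(* For [k = 0] the value [lam 1] is unconstrained, so the scale of the single point is set to 1. *)
pose e := if k == 0%N then 1 else lam 1%N / 2.
have e0 : 0 < e.
  rewrite /e; case: ifPn => [_|k0]; first exact: ltr01.
  by rewrite divr_gt0// -z; apply: inc; rewrite /= lt0n.
have eE j : (j <= k)%N -> lam j = 2 * e * j%:R.
  move=> jk; rewrite lamE// /e; case: eqP => [k0|_]; last by lra.
  by move: jk; rewrite k0 leqn0 => /eqP ->; rewrite mul0r mulr0.
exists (x0 + const_mx (e * k%:R)), e; split => //.
apply: sub_copy_eq => //; [exact: lt0r_neq0|exact: finite_zball|].
move=> y /subg[j jk <-]; exists (const_mx (2 * j%:Z - k%:Z)).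
  split; rewrite /l1norm big_ord1 mxE; first by move: jk; rewrite /=; lia.
  by lia.
by apply/rowP => t; rewrite !mxE eE// intrB intrM; ring.
Qed.

(** The same passage through a maximal set as on spheres. The induction on [k] is strong, since the
    interior loses two distances and the index of the diameter may drop. *)
Lemma ball_claim_all (R : realType) :
  (forall d k, (0 < d)%N -> (0 < k)%N ->
     (forall P : set 'rV[R]_d,
        maximal_size [set Q : set 'rV[R]_d | at_most_dists k Q] P ->
        axis_parallel P)
     /\
     (forall P : set 'rV[R]_d,
        maximal_size
          [set Q : set 'rV[R]_d | in_some_l1sphere Q /\ at_most_dists k Q] P ->
        axis_parallel P)) ->
  forall d k, ball_claim R d.+1 k.
Proof.
move=> HA [|d] k; first exact: ball_claim1.
have claim : sphere_claim R d.+2.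
  by apply: sphere_claim_all => d' k' d'0 k'0; case: (HA d' k' d'0 k'0).
elim/ltn_ind: k => -[_|k IH]; first exact: ball_claim0.
have core (P : set 'rV[R]_d.+2) : at_most_dists k.+1 P -> axis_parallel P ->
  exists2 l, (l <= k.+1)%N & P #<= zball d.+2 l /\ (zball d.+2 l #<= P ->
    exists m e, 0 < e /\ P = copy m e (zball d.+2 l)).
  move=> /dist_enum_ex[l' l'k [lam eP]].
  move=> /(axis_parallel_center eP)[l [i [m [/andP[l0 ll'] eQ top bot ball]]]].
  have lk := leq_trans ll' l'k; exists l => //.
  have IHl t : (t < l)%N -> ball_claim R d.+2 t by move=> tl; apply: IH; exact: leq_trans tl lk.
  split.
    by rewrite -(card_le_eql (shift_card P m)); exact: ball_core_le eQ ball top bot.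
  rewrite -(card_le_eqr (shift_card P m)).
  move=> /(ball_core_eq claim IHl l0 eQ ball top bot)[m' [e [e0 E]]].
  by exists (m' + m), e; split => //; exact: shift_copy.
have bound (Q : set 'rV[R]_d.+2) : at_most_dists k.+1 Q -> Q #<= zball d.+2 k.+1.
  move=> Qk.
  have [||N [Nk Nmax]] := @ex_maximal_size _
      [set Q : set 'rV[R]_d.+2 | at_most_dists k.+1 Q]
      (few_dists_bound d.+2 k.+1); [by exists Q| |].
    by move=> M; exact: at_most_dists_bound.
  have [|l lk [Nl _]] := core N Nk.
    by have [HA1 _] := HA d.+2 k.+1 isT isT; apply: HA1; split.
  apply: (card_le_trans (Nmax Q _)); first by [].
  by apply: card_le_trans Nl _; exact: zball_le.
move=> P Pk; split; first exact: bound.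
move=> kP; have [|l lk [Pl Pe]] := core P Pk.
  have [HA1 _] := HA d.+2 k.+1 isT isT; apply: HA1; split => // Q Qk.
  exact: card_le_trans (bound Q Qk) kP.
have kl : l = k.+1.
  apply/eqP; rewrite eqn_leq lk; apply: (@zball_ge d.+1).
  exact: card_le_trans kP Pl.
by move: Pe; rewrite kl; apply.
Qed.

(** * Similarity and the conclusion *)

Lemma l1_similarity_inj (R : realType) d (f : 'rV[R]_d -> 'rV[R]_d) :
  l1_similarity f -> injective f.
Proof.
elim=> {f} [v|i|c c0|s|f g _ fi _ gi].
- exact: addIr.
- move=> x y /rowP e; apply/rowP => j; have := e j; rewrite !mxE.
  by case: eqP => // _ /oppr_inj.
- by apply: scalerI; exact: lt0r_neq0.
- move=> x y /rowP e; apply/rowP => j; have := e (s^-1%g j).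
  by rewrite !mxE permKV.
- exact: inj_comp.
Qed.

Theorem theorem6p3 (R : realType) :
  (forall d k : nat, (0 < d)%N -> (0 < k)%N ->
     (forall P : set 'rV[R]_d,
        maximal_size [set Q : set 'rV[R]_d | at_most_dists k Q] P ->
        axis_parallel P)
     /\
     (forall P : set 'rV[R]_d,
        maximal_size
          [set Q : set 'rV[R]_d | in_some_l1sphere Q /\ at_most_dists k Q] P ->
        axis_parallel P)) ->
  (forall d k : nat, (0 < d)%N -> (0 < k)%N ->
     forall P : set 'rV[R]_d, at_most_dists k P ->
       P #<= Lambda R d k /\
       (P #= Lambda R d k <-> l1_similar P (Lambda R d k))).
Proof.
move=> HA [//|d] k _ _ P Pk.
have [le eq] := ball_claim_all HA Pk.
have LE : Lambda R d.+1 k #= zball d.+1 k.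
  by apply: inj_card_eq => x y _ _; exact: emb_inj.
split; first by rewrite (card_le_eqr LE).
split=> [|[f /l1_similarity_inj fi <-]]; last first.
  by apply: card_esym; apply: inj_card_eq => x y _ _; exact: fi.
rewrite (card_eqr LE) card_eq_le => /andP[_ /eq[m [e [e0 ->]]]].
(* Translating by [- m] and dilating by [e^-1] undoes the copy. *)
exists ((fun x => e^-1 *: x) \o (fun x => x + - m)).
  apply: l1sim_comp; last exact: l1sim_translation.
  by apply: l1sim_dilation; rewrite invr_gt0.
have fE n : e^-1 *: (m + e *: emb R n - m) = emb R n.
  by rewrite addrAC subrr add0r scalerA mulVf ?scale1r// lt0r_neq0.
apply/seteqP; split => [_ [_ [n nB <-] <-]|_ [n nB <-]].
  by exists n => //=; rewrite fE.
by exists (m + e *: emb R n); [exists n|exact: fE].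
Qed.
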